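(* Let $\boldsymbol\beta_2=(\beta_0,\beta_1,\beta_2)$ with $\beta_k\ge 0$, let $\mathbf{W}=(W,\mathbb{W})\in \mathbf{C}^{\alpha,\boldsymbol\beta_2}([0,T]\times V;V)$ be a nonlinear rough path and let $(Y,\dot Y)\in\mathcal{E}^{2\alpha}_W$. Define $$\Xi_{s,t}=W_{s,t}(Y_s)+\mathbb{W}_{s,t}(\dot Y_s,Y_s).$$ Then for all $0\le s\le t\le T$ the limit $$\mathcal{J}_{s,t}(\Xi):=\lim_{|\pi|\to0}\sum_{k=1}^n\Xi_{t_{k-1},t_k}$$ over partitions $\pi=(s=t_0<t_1<\dots<t_n=t)$ with mesh $|\pi|\to 0$ exists. Moreover $$\|\mathcal{J}_{s,t}(\Xi)-\Xi_{s,t}\|_V\le C_1|t-s|^{3\alpha},$$ where $$C_1=k_\alpha\|\mathbf{W}\|_{\mathbf{C}_2}(1+2\|\dot Y\|_\infty)^{\max(\beta_0,\beta_1)}(1+2\|Y\|_\infty)^{\max(\beta_1,\beta_2)}\big(\|Y\|_\alpha+\|\dot Y\|_\alpha+\|R^Y\|_{2\alpha}\big),\qquad k_\alpha=(1-2^{1-3\alpha})^{-1}.$$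
   Context: Fix $T>0$, $\alpha\in(\frac13,\frac12]$ and a separable Banach space $V$. For a function $\Phi$ of time, $\Phi_{s,t}:=\Phi_t-\Phi_s$ (for $W(t,x)$: $W_{s,t}(x)=W(t,x)-W(s,x)$). $\mathcal{C}^\alpha([0,T];V)$ is the space of $Y:[0,T]\to V$ with $\|Y\|_\alpha=\sup_{s\ne t}\|Y_{s,t}\|_V/|t-s|^\alpha<\infty$; $\|Y\|_\infty=\sup_t\|Y_t\|_V$; $\mathcal{C}_2^{2\alpha}([0,T]^2;V)$ is the space of $R:[0,T]^2\to V$ with $\|R\|_{2\alpha}=\sup_{s\ne t}\|R_{s,t}\|_V/|t-s|^{2\alpha}<\infty$. For $\boldsymbol\beta_n=(\beta_0,\dots,\beta_n)$ with $\beta_k\ge0$, $\mathcal{C}^{\alpha,\boldsymbol\beta_n}([0,T]\times V;V)$ is the space of functions $\Phi$, $n$ times continuously Fréchet differentiable in space, with $$\|\Phi\|_{\alpha,\boldsymbol\beta_n}=\sum_{k=0}^n\sup_{s\ne t,\,x\in V}\frac{\|D^k\Phi_{s,t}(x)\|}{|t-s|^\alpha(1+\|x\|_V)^{\beta_k}}<\infty .$$ For multi-indices $\boldsymbol\beta^1,\boldsymbol\beta^2$ of length $m+1$ and $\gamma>0$, $\mathcal{C}_2^{\gamma,\boldsymbol\beta^1,\boldsymbol\beta^2}([0,T]^2\times V^2;V)$ is the space of $\Psi$, $m$ times continuously Fréchet differentiable in $(x_1,x_2)\in V^2$ (normed by $\|x_1\|_V+\|x_2\|_V$), with $$\|\Psi\|_{\gamma,\boldsymbol\beta^1,\boldsymbol\beta^2}=\sum_{k=0}^m\sup_{s\ne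 t,\,(x_1,x_2)\in V^2}\frac{\|D^k\Psi_{s,t}(x_1,x_2)\|}{|t-s|^\gamma(1+\|x_1\|_V)^{\beta^1_k}(1+\|x_2\|_V)^{\beta^2_k}}<\infty .$$ Given $\boldsymbol\beta_n$, $n\ge1$, set $\beta^*_k=\max\{\beta_0,\dots,\beta_k\}$, $\beta^{**}_k=\max\{\beta_1,\dots,\beta_{k+1}\}$ for $0\le k\le n-1$, $\boldsymbol\beta^*_{n-1}=(\beta^*_0,\dots,\beta^*_{n-1})$, $\boldsymbol\beta^{**}_{n-1}=(\beta^{**}_0,\dots,\beta^{**}_{n-1})$. A nonlinear rough path $\mathbf{W}=(W,\mathbb{W})\in\mathbf{C}^{\alpha,\boldsymbol\beta_n}([0,T]\times V;V)$ is a pair with $W\in\mathcal{C}^{\alpha,\boldsymbol\beta_n}([0,T]\times V;V)$, $\mathbb{W}\in\mathcal{C}_2^{2\alpha,\boldsymbol\beta^*_{n-1},\boldsymbol\beta^{**}_{n-1}}([0,T]^2\times V^2;V)$, satisfying Chen's relation $\mathbb{W}_{s,t}(x,y)-\mathbb{W}_{s,u}(x,y)-\mathbb{W}_{u,t}(x,y)=DW_{u,t}(y)(W_{s,u}(x))$ for all $x,y\in V$, $s,u,t\in[0,T]$. Set $\|\mathbf{W}\|_{\mathbf{C}_n}=\|W\|_{\alpha,\boldsymbol\beta_n}+\|\mathbb{W}\|_{2\alpha,\boldsymbol\beta^*_{n-1},\boldsymbol\beta^{**}_{n-1}}$. $\mathcal{E}_W^{2\alpha}$ is the set of pairs $(Y,\dot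 Y)\in\mathcal{C}^\alpha([0,T];V)^2$ such that $R^Y_{s,t}:=Y_{s,t}-W_{s,t}(\dot Y_s)$ belongs to $\mathcal{C}_2^{2\alpha}([0,T]^2;V)$. *)

(* Defs.v *)
From HB Require Import structures.
From mathcomp Require Import all_boot all_order all_algebra.
From mathcomp Require Import all_classical all_reals all_analysis.

Set Implicit Arguments.
Unset Strict Implicit.
Unset Printing Implicit Defensive.

Import Order.TTheory GRing.Theory Num.Theory.
Import numFieldNormedType.Exports.

Local Open Scope classical_set_scope.
Local Open Scope ring_scope.

Definition separable (T : topologicalType) : Prop :=
  exists2 S : set T, countable S & dense S.

Section clin_pred.
Context {R : realType} {V W : normedModType R}.

Definition clin : {pred V -> W} :=
  [pred f : V -> W | `[< linear f /\ continuous f >]].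

Lemma clin_submod_closed : submod_closed clin.
Proof.
split=> [|a f g].
  apply/asboolP; split=> [k u v|x]; first by rewrite -[LHS]/(0 : W) scaler0 addr0.
  exact: cvg_cst.
move=> /asboolP[lf cf] /asboolP[lg cg]; apply/asboolP; split=> [k u v|x].
  rewrite !fctE lf lg !scalerDr !scalerA (mulrC a) -!addrA; congr (_ + _).
  by rewrite addrCA.
by apply: cvgD; [apply: cvgZr; exact: cf|exact: cg].
Qed.

HB.instance Definition _ :=
  GRing.isSubmodClosed.Build R (V -> W) clin clin_submod_closed.

End clin_pred.
Arguments clin {R} V W.

Record clinear (R : realType) (V W : normedModType R) :=
  CLinear { clin_fun :> V -> W ; _ : clin_fun \in clin V W }.

Section clinear_normed.
Context {R : realType} {V W : normedModType R}.
Implicit Types f g : clinear V W.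

HB.instance Definition _ := [isSub for @clin_fun R V W].
HB.instance Definition _ := [Choice of clinear V W by <:].
HB.instance Definition _ := [SubChoice_isSubLmodule of clinear V W by <:].

Lemma clinearP (f : clinear V W) : linear f /\ continuous f.
Proof. by case: f => f /= /asboolP. Qed.

Definition opnorm (f : clinear V W) : R :=
  sup [set `|f x| | x in [set x : V | `|x| <= 1]].

Let lin (f : clinear V W) : {linear V -> W} :=
  HB.pack (f : V -> W) (GRing.isLinear.Build _ _ _ _ _ (clinearP f).1).

Let has_sup_opnorm f : has_sup [set `|f x| | x in [set x : V | `|x| <= 1]].
Proof.
split; first by exists `|f 0|, 0 => //=; rewrite normr0.
have /linear_bounded_continuous/bounded_funP/(_ 1)[M fM] :
  continuous (lin f) := (clinearP f).2.
by exists M => _ [x /= x1 <-]; exact: fM.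
Qed.

Let opnorm_ub f x : `|x| <= 1 -> `|f x| <= opnorm f.
Proof. by move=> x1; apply: ub_le_sup; [case: (has_sup_opnorm f)|exists x]. Qed.

Let opnorm_lub f M : (forall x, `|x| <= 1 -> `|f x| <= M) -> opnorm f <= M.
Proof.
move=> fM; apply: ge_sup; first by case: (has_sup_opnorm f).
by move=> _ [x /= x1 <-]; exact: fM.
Qed.

Lemma ler_opnormD f g : opnorm (f + g) <= opnorm f + opnorm g.
Proof.
apply: opnorm_lub => x x1.
by rewrite (le_trans (ler_normD _ _))// lerD ?opnorm_ub.
Qed.

Lemma opnorm_ge0 f : 0 <= opnorm f.
Proof.
by apply: (le_trans (normr_ge0 (f 0))); apply: opnorm_ub; rewrite normr0.
Qed.

Let ler_opnormZ a f : opnorm (a *: f) <= `|a| * opnorm f.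
Proof.
by apply: opnorm_lub => x x1; rewrite normrZ ler_wpM2l// opnorm_ub.
Qed.

Lemma opnormZ a f : opnorm (a *: f) = `|a| * opnorm f.
Proof.
apply/eqP; rewrite eq_le ler_opnormZ/=; have [->|a0] := eqVneq a 0.
  by rewrite normr0 mul0r opnorm_ge0.
rewrite -ler_pdivlMl ?normr_gt0// -normfV.
by apply: le_trans (ler_opnormZ _ _); rewrite scalerA mulVf// scale1r.
Qed.

Lemma opnorm_le f x : `|f x| <= opnorm f * `|x|.
Proof.
have [->|x0] := eqVneq x 0.
  by rewrite normr0 mulr0 -[clin_fun f]/(lin f : V -> W) linear0 normr0.
have -> : `|f x| = `|f (`|x|^-1 *: x)| * `|x|.
  rewrite -[clin_fun f]/(lin f : V -> W) linearZ/= normrZ normfV normr_id.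
  by rewrite mulrAC mulVf ?mul1r// normr_eq0.
by rewrite ler_wpM2r// opnorm_ub// normfZV.
Qed.

Lemma opnorm_eq0 f : opnorm f = 0 -> f = 0.
Proof.
move=> f0; apply: val_inj; apply/funext => x /=.
by apply/eqP; rewrite -normr_le0 (le_trans (opnorm_le f x))// f0 mul0r.
Qed.

HB.instance Definition _ :=
  Lmodule_isNormed.Build R (clinear V W) ler_opnormD opnormZ opnorm_eq0.

Lemma clinear_normE f :
  `|f| = sup [set `|f x| | x in [set x : V | `|x| <= 1]].
Proof. by []. Qed.

End clinear_normed.

(* The library norms U * V by the maximum of the norms of the components; here
   the product carries their sum. *)
Definition sumprod (R : realType) (U V : normedModType R) := (U * V)%type.

Section sumprod_normed.
Context {R : realType} {U V : normedModType R}.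

HB.instance Definition _ := GRing.Lmodule.on (sumprod U V).

Definition sumprod_norm (x : sumprod U V) : R := `|x.1| + `|x.2|.

Lemma ler_sumprod_normD x y :
  sumprod_norm (x + y) <= sumprod_norm x + sumprod_norm y.
Proof. by rewrite /sumprod_norm addrACA lerD// ler_normD. Qed.

Lemma sumprod_normZ a x : sumprod_norm (a *: x) = `|a| * sumprod_norm x.
Proof. by rewrite /sumprod_norm !normrZ mulrDr. Qed.

Lemma sumprod_norm_eq0 x : sumprod_norm x = 0 -> x = 0.
Proof.
case: x => x y /eqP; rewrite /sumprod_norm/= paddr_eq0// !normr_eq0.
by move=> /andP[/eqP-> /eqP->].
Qed.

HB.instance Definition _ := Lmodule_isNormed.Build R (sumprod U V)
  ler_sumprod_normD sumprod_normZ sumprod_norm_eq0.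

Lemma sumprod_normE (x : sumprod U V) : `|x| = `|x.1| + `|x.2|.
Proof. by []. Qed.

End sumprod_normed.

Section frechet.
Context {R : realType}.
Implicit Types V W : normedModType R.

(* L(V, L(V, ... L(V, W))), with k copies of V; isometric to the space of
   bounded k-linear maps. *)
Fixpoint klin (k : nat) V W : normedModType R :=
  if k is k'.+1 then clinear V (klin k' V W) else W.

(* 'd f x as an element of L(V, W); it has the junk value 0 if the library's
   differential is not continuous, hence only where f is not
   differentiable. *)
Definition frechet V W (f : V -> W) (x : V) : clinear V W :=
  insubd 0 ('d f x : V -> W).

Lemma frechetE V W (f : V -> W) (x : V) :
  differentiable f x -> frechet f x = 'd f x :> (V -> W).
Proof.
move=> dfx; rewrite /frechet -[LHS]/(val _) insubdK//.
apply/asboolP; split; first exact: linearP.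
exact: diff_continuous.
Qed.

Fixpoint iter_frechet (k : nat) V W (f : V -> W) : V -> klin k V W :=
  if k is k'.+1 then frechet (iter_frechet k' f) else f.

Definition is_Cn (n : nat) V W (f : V -> W) : Prop :=
  (forall k, (k < n)%N -> forall x, differentiable (iter_frechet k f) x) /\
  continuous (iter_frechet n f).

End frechet.

Section path_spaces.
Context {R : realType} {V : normedModType R}.
Variable T : R.

Definition time_pairs : set (R * R) :=
  [set p | [/\ 0 <= p.1 <= T, 0 <= p.2 <= T & p.1 != p.2]].

Definition incr (E : zmodType) (Y : R -> E) (s t : R) : E := Y t - Y s.

Definition enorm2 (g : R) (F : R -> R -> V) : \bar R :=
  ereal_sup [set (`|F p.1 p.2| / `|p.2 - p.1| `^ g)%:E | p in time_pairs].

Definition enorm_holder (a : R) (Y : R -> V) : \bar R := enorm2 a (incr Y).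

Definition enorm_oo (Y : R -> V) : \bar R :=
  ereal_sup [set (`|Y t|)%:E | t in [set t | 0 <= t <= T]].

Definition holder_space (a : R) (Y : R -> V) : Prop :=
  (enorm_holder a Y < +oo)%E.

Definition space2 (g : R) (F : R -> R -> V) : Prop := (enorm2 g F < +oo)%E.

(* In the next four definitions b, b1, b2 are multi-indices: only their values
   at 0, ..., n (resp. 0, ..., m) are used. *)
Definition enorm_field (a : R) (n : nat) (b : nat -> R) (Phi : R -> V -> V) :
    \bar R :=
  (\sum_(k < n.+1)
    ereal_sup [set (`|iter_frechet k (incr Phi q.1.1 q.1.2) q.2| /
                    (`|q.1.2 - q.1.1| `^ a * (1 + `|q.2|) `^ b k))%:E
              | q in time_pairs `*` [set: V]])%E.

Definition field_space (a : R) (n : nat) (b : nat -> R) (Phi : R -> V -> V) :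
    Prop :=
  (forall t, 0 <= t <= T -> is_Cn n (Phi t)) /\
  (enorm_field a n b Phi < +oo)%E.

Definition enorm_field2 (g : R) (m : nat) (b1 b2 : nat -> R)
    (Psi : R -> R -> sumprod V V -> V) : \bar R :=
  (\sum_(k < m.+1)
    ereal_sup [set (`|iter_frechet k (Psi q.1.1 q.1.2) q.2| /
                    (`|q.1.2 - q.1.1| `^ g *
                     (1 + `|q.2.1|) `^ b1 k * (1 + `|q.2.2|) `^ b2 k))%:E
              | q in time_pairs `*` [set: sumprod V V]])%E.

Definition field_space2 (g : R) (m : nat) (b1 b2 : nat -> R)
    (Psi : R -> R -> sumprod V V -> V) : Prop :=
  (forall s t, 0 <= s <= T -> 0 <= t <= T -> is_Cn m (Psi s t)) /\
  (enorm_field2 g m b1 b2 Psi < +oo)%E.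

Definition bstar (b : nat -> R) (k : nat) : R :=
  \big[Num.max/b 0%N]_(i < k.+1) b i.

Definition bstar2 (b : nat -> R) (k : nat) : R := bstar (fun i => b i.+1) k.

Definition chen (W : R -> V -> V) (WW : R -> R -> sumprod V V -> V) : Prop :=
  forall x y s u t, 0 <= s <= T -> 0 <= u <= T -> 0 <= t <= T ->
    WW s t (x, y) - WW s u (x, y) - WW u t (x, y) =
    frechet (incr W u t) y (incr W s u x).

Definition nl_rough_path (a : R) (n : nat) (b : nat -> R)
    (W : R -> V -> V) (WW : R -> R -> sumprod V V -> V) : Prop :=
  [/\ field_space a n b W,
      field_space2 (2 * a) n.-1 (bstar b) (bstar2 b) WW &
      chen W WW].

Definition norm_rough_path (a : R) (n : nat) (b : nat -> R)
    (W : R -> V -> V) (WW : R -> R -> sumprod V V -> V) : R :=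
  fine (enorm_field a n b W) +
  fine (enorm_field2 (2 * a) n.-1 (bstar b) (bstar2 b) WW).

Definition remainder (W : R -> V -> V) (Y dY : R -> V) (s t : R) : V :=
  incr Y s t - incr W s t (dY s).

Definition controlled (a : R) (W : R -> V -> V) (Y dY : R -> V) : Prop :=
  [/\ holder_space a Y, holder_space a dY &
      space2 (2 * a) (remainder W Y dY)].

End path_spaces.

Section sewing.
Context {R : realType}.

(* A partition s = t_0 < ... < t_n = t is the sequence p = [:: t_1; ...; t_n]
   with itv_partition s t p; for s = t the only one is [::]. *)
Definition mesh (s : R) (p : seq R) : R :=
  \big[Num.max/0]_(0 <= k < size p) (nth 0 (s :: p) k.+1 - nth 0 (s :: p) k).

Definition partition_sum (V : zmodType) (Xi : R -> R -> V) (s : R)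
    (p : seq R) : V :=
  \sum_(0 <= k < size p) Xi (nth 0 (s :: p) k) (nth 0 (s :: p) k.+1).

Definition mesh_filter (s t : R) : set_system (seq R) :=
  filter_from [set d : R | 0 < d]
    (fun d => [set p | itv_partition s t p /\ mesh s p < d]).

#[global] Instance mesh_filter_filter s t : Filter (mesh_filter s t).
Proof.
apply: filter_from_filter; first by exists 1 => /=.
move=> d e /= d0 e0; exists (Num.min d e) => /=; first by rewrite lt_min d0.
by move=> p [ip]; rewrite lt_min => /andP[pd pe].
Qed.

Lemma mesh_filter_proper s t : s <= t -> ProperFilter (mesh_filter s t).
Proof.
move=> st; apply: filter_from_proper => d /= d0.
have main n : forall s, s <= t -> t - s < n%:R * (d / 2) ->
    exists p, itv_partition s t p /\ mesh s p < d.
  elim: n => [x xt|n ih x xt xn].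
    by rewrite mul0r subr_lt0 ltNge xt.
  have [ltxt|] := ltP x t; last first.
    move=> tx; exists [::]; split; first by split=> //=; rewrite eq_le xt.
    by rewrite /mesh big_nil.
  have d20 : d / 2 < d by rewrite ltr_pdivrMr// ltr_pMr// ltr1n.
  have [xd|xd] := leP (x + d / 2) t; last first.
    exists [:: t]; split; first exact: itv_partition1.
    rewrite /mesh/= big_ltn// big_geq//= gt_max d0 andbT.
    by rewrite (lt_trans _ d20)// ltrBlDl.
  have [|p [ip mp]] := ih _ xd.
    by rewrite opprD addrA ltrBlDr (lt_le_trans xn)// -natr1 mulrDl mul1r.
  exists (x + d / 2 :: p); split.
    case: ip => pp pl; split=> //=.
    by rewrite pp andbT ltrDl divr_gt0.
  rewrite /mesh/= big_nat_recl//= gt_max addrAC subrr add0r d20/=.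
  exact: mp.
have d2 : 0 < d / 2 by rewrite divr_gt0.
apply: (main (Num.truncn ((t - s) / (d / 2))).+1 s st).
by rewrite -ltr_pdivrMr// truncnS_gt.
Qed.

Definition sewing (V : normedModType R) (Xi : R -> R -> V) (s t : R) : V :=
  lim (partition_sum Xi s p @[p --> mesh_filter s t]).

End sewing.

(* Main.v *)
Require Import Defs.
From HB Require Import structures.
From mathcomp Require Import all_boot all_order all_algebra.
From mathcomp Require Import all_classical all_reals all_analysis.
From mathcomp Require Import ring lra.

Import Order.TTheory GRing.Theory Num.Theory.
Import numFieldNormedType.Exports.

Local Open Scope classical_set_scope.
Local Open Scope ring_scope.

Set Implicit Arguments.
Unset Strict Implicit.
Unset Printing Implicit Defensive.

(** The germ Xi is almost additive: for s <= u <= t the defect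
    Xi_{s,t} - Xi_{s,u} - Xi_{u,t} is of order |t - s|^{3a} with 3a > 1, and a
    germ with this property can be sewn.  The delicate point is the constant,
    which must be linear in the norm of the rough path and in the norms of
    (Y, Y').

    The defect.  Chen's relation turns the defect into
      W_{u,t}(Y_s) - W_{u,t}(Y_u) + DW_{u,t}(Y_s)(w)
        - (WW_{u,t}(Y'_u, Y_u) - WW_{u,t}(Y'_s, Y_s)),   w = W_{s,u}(Y'_s).
    Expanding W_{u,t} to second order would produce |Y_{s,u}|^2, and comparing
    DW_{u,t} at two points before applying it to w would produce the product of
    two norms of W.  Instead, along the segment y_x = Y_s + x Y_{s,u} one writes
    Y_{s,u} = w + R_{s,u} and reads Chen's relation backwards:
      DW_{u,t}(y_x)(w) = (WW_{s,t} - WW_{s,u} - WW_{u,t})(Y'_s, y_x),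
    so that bounds on the first derivative of WW suffice.  The derivative in x
    of the interpolated defect is then bounded by an affine function of x, and
    integrating it gives the factors 1/2 without which the constant would be
    too large ([germ_defect]).  The integration is a mean value inequality with
    a real comparison function ([mean_value_inequality]).

    The numerical constant.  If u is the midpoint of [s, t] and p = 2^{-a}, the
    increments over the two halves carry powers of p with p^3 <= 1/2.  The
    coefficient of the norm of Y is then (p + 2 p^3)/2 <= 1, those of the norms
    of Y' and R are p^3 <= 1, so the defect at midpoints is at most the wanted
    constant without the factor k_a ([rough_germ_midpoint]).  For arbitrary u
    twice this constant is enough ([rough_germ_almost_additive]).

    Sewing.  Cutting a partition at the interval that straddles the middle of
    [s, t] leaves two partitions of intervals of length at most |t - s|/2; by
    induction the partition sum differs from the germ by C |t - s|^{3a}, because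
    2 (1/2)^{3a} = 2^{1-3a} < 1 ([partition_sum_germ]).  Hence a refinement of a
    partition of mesh at most d changes the sum by O(d^{3a-1}), and two
    partitions are compared through a common refinement: the sums are Cauchy.
    The limit may be computed along dyadic partitions alone, where only defects
    at midpoints occur; the same induction then gives the constant times
    1 / (1 - 2^{1-3a}) = k_a ([sewing_germ]). *)

(** * A mean value inequality for vector-valued functions *)

Section mean_value.
Context {R : realType} {V : normedModType R}.

(** A vector-valued function has no mean value theorem, but a comparison
    function g transports the bound: for every slope e > 0 the set of x at which
    |f x - f a| <= g x - g a + e (x - a) is closed, and it extends to the right
    of each of its points below b, hence its supremum is b. *)
Theorem mean_value_inequality (f : R -> V) (g : R -> R) (df : R -> V)
    (dg : R -> R) (a b : R) :
  (forall x, a <= x <= b -> is_derive x 1 f (df x)) ->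
  (forall x, a <= x <= b -> is_derive x 1 g (dg x)) ->
  (forall x, a <= x <= b -> `|df x| <= dg x) ->
  a <= b -> `|f b - f a| <= g b - g a.
Proof.
move=> fd gd fg ab; apply/ler_addgt0Pr => e0 e00.
(* The summand 1 keeps the denominator positive when a = b. *)
pose e := e0 / (b - a + 1).
have e_gt0 : 0 < e by rewrite divr_gt0//; lra.
have eba : e * (b - a) <= e0.
  rewrite /e mulrAC ler_pdivrMr; nra.
pose h x := g x - g a + e * (x - a) - `|f x - f a|.
suff : 0 <= h b by rewrite /h; lra.
have cont x : a <= x <= b -> h @ x --> h x.
  move=> axb.
  have cf : f @ x --> f x.
    apply: differentiable_continuous; apply/derivable1_diffP.
    exact: (@ex_derive _ _ _ _ _ _ _ (fd x axb)).
  have cg : g @ x --> g x.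
    apply: differentiable_continuous; apply/derivable1_diffP.
    exact: (@ex_derive _ _ _ _ _ _ _ (gd x axb)).
  apply: cvgB; last by apply: cvg_norm; apply: cvgB => //; exact: cvg_cst.
  apply: cvgD; first by apply: cvgB => //; exact: cvg_cst.
  by apply: cvgM; [exact: cvg_cst|apply: cvgB; [exact: cvg_id|exact: cvg_cst]].
pose S := [set x | a <= x <= b /\ 0 <= h x].
have Sa : S a.
  by split; [rewrite lexx|rewrite /h !subrr mulr0 addr0 normr0 subr0].
have ubS : has_sup S.
  by split; [exists a|exists b => x [/andP[]]].
pose c := sup S.
have acb : a <= c <= b.
  apply/andP; split; first by apply: ub_le_sup => //; case: ubS.
  by apply: ge_sup; [exists a|move=> x [/andP[]]].
have hc : 0 <= h c.
  rewrite leNgt; apply/negP => hc0.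
  have := cvgr_lt _ (cont _ acb) _ hc0.
  move=> [r /= r0 rP].
  have [x Sx cx] := sup_adherent r0 ubS.
  have : h x < 0.
    apply: rP => /=; rewrite ger0_norm; first by rewrite /c; lra.
    by rewrite subr_ge0 ub_le_sup//; case: ubS.
  by case: Sx => _ ?; lra.
have [->//|cb] := eqVneq b c; exfalso.
have {}cb : c < b by rewrite lt_neqAle eq_sym cb; case/andP: acb.
have e2 : 0 < e / 2 by lra.
have quot (E : normedModType R) (u : R -> E) du : is_derive c 1 u du ->
    \forall x \near c^'+, `|u x - u c - (x - c) *: du| <= e / 2 * (x - c).
  move=> ud; have uq := @ex_derive _ _ _ _ _ _ _ ud.
  have ul :
      (fun h : R => h^-1 *: ((u \o shift c) (h *: 1) - u c)) @ 0^' --> du.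
    by rewrite -(@derive_val _ _ _ _ _ _ _ ud); exact: uq.
  move/cvgrPdist_le : ul => /(_ _ e2)[r /= r0 rP].
  near=> x.
  have cx : 0 < x - c by rewrite subr_gt0; near: x; exact: nbhs_right_gt.
  have xr : x - c < r by near: x; exact: nbhs_right_ltDr.
  have := rP (x - c); rewrite /= sub0r normrN gtr0_norm// => /(_ xr).
  move=> /(_ (lt0r_neq0 cx)); rewrite [_ *: 1]mulr1 subrK => uP.
  rewrite -[u x - u c](scalerKV (lt0r_neq0 cx)) -scalerBr normrZ gtr0_norm//.
  by rewrite mulrC ler_pM2r// distrC.
have qf := quot _ _ _ (fd c acb); have qg := quot _ _ _ (gd c acb).
near c^'+ => x.
have cx : c < x by near: x; exact: nbhs_right_gt.
have xb : x < b by near: x; exact: nbhs_right_lt.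
have fx : `|f x - f c - (x - c) *: df c| <= e / 2 * (x - c) by near: x.
have gx : `|g x - g c - (x - c) *: dg c| <= e / 2 * (x - c) by near: x.
suff : S x by move/(ub_le_sup ubS.2); rewrite -/c leNgt cx.
split; first by case/andP: acb => ac _; apply/andP; split; lra.
have n1 : `|f x - f a| <= `|f x - f c - (x - c) *: df c| +
    `|(x - c) *: df c| + `|f c - f a|.
  rewrite (le_trans _ (lerD (ler_normD _ _) (lexx _)))//.
  by rewrite subrK (le_trans _ (ler_normD _ _))// addrA subrK.
rewrite normrZ gtr0_norm ?subr_gt0// in n1.
have cx0 : 0 < x - c by rewrite subr_gt0.
have dfc : (x - c) * `|df c| <= (x - c) * dg c by rewrite ler_pM2l// fg.
move: gx => /ler_normlP[]; rewrite -[(x - c) *: dg c]/((x - c) * dg c) => gx _.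
by move: hc; rewrite /h; lra.
Unshelve. all: by end_near. Qed.

End mean_value.

(** * Derivatives along segments *)

Section segments.
Context {R : realType}.

Lemma is_derive_segment (E F : normedModType R) (f : E -> F) (p v : E) (x : R) :
  differentiable f (p + x *: v) ->
  is_derive x 1 (fun y => f (p + y *: v)) (frechet f (p + x *: v) v).
Proof.
move=> fx; set z := p + x *: v.
have quotE : (fun h : R => h^-1 *: ((f \o shift z) (h *: v) - f z)) =
    (fun h : R => h^-1 *:
      (((fun y => f (p + y *: v)) \o shift x) (h *: 1) - f z)).
  apply/funext => h /=; congr (_ *: (f _ - _)).
  by rewrite [_ *: 1]mulr1 scalerDl addrCA.
apply: DeriveDef.
  by have := @diff_derivable _ _ _ f _ v fx; rewrite /derivable quotE.
by rewrite frechetE// -deriveE// /derive quotE.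
Qed.

Lemma is_derive_scalel (V : normedModType R) (c : V) (x : R) :
  is_derive x 1 (fun y : R => y *: c) c.
Proof.
have sc := is_diff_scalel x c; apply: DeriveDef; first exact: diff_derivable.
by rewrite deriveE// diff_val scale1r.
Qed.

Lemma segment_ball (V : normedModType R) (p q : V) (r x : R) :
  `|p| <= r -> `|q| <= r -> 0 <= x <= 1 -> `|p + x *: (q - p)| <= r.
Proof.
move=> pr qr /andP[x0 x1].
have -> : p + x *: (q - p) = (1 - x) *: p + x *: q.
  by rewrite scalerBr scalerBl scale1r addrAC -addrA addrC.
rewrite (le_trans (ler_normD _ _))// !normrZ ger0_norm ?subr_ge0// ger0_norm//.
have : (1 - x) * `|p| <= (1 - x) * r by rewrite ler_wpM2l// subr_ge0.
have : x * `|q| <= x * r by rewrite ler_wpM2l.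
lra.
Qed.

Lemma frechet_lipschitz (E F : normedModType R) (f : E -> F) (p q : E) (L : R) :
  (forall x, differentiable f x) ->
  (forall x : R, 0 <= x <= 1 -> `|frechet f (p + x *: (q - p))| <= L) ->
  `|f q - f p| <= L * `|q - p|.
Proof.
move=> df dfL.
have := @mean_value_inequality _ _ (fun x : R => f (p + x *: (q - p)))
  (fun x => L * `|q - p| * x) (fun x => frechet f (p + x *: (q - p)) (q - p))
  (fun=> L * `|q - p|) 0 1.
rewrite scale0r scale1r addr0 (addrC p) subrK mulr0 mulr1 subr0; apply => //.
- by move=> x _; exact: is_derive_segment.
- by move=> x _; apply: is_derive_eq; rewrite /GRing.scale/= mulr1.
- by move=> x x01; rewrite (le_trans (opnorm_le _ _))// ler_wpM2r// dfL.
Qed.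

(** The defect of the germ, for one triple s <= u <= t: f is W_{u,t}, F is
    WW_{u,t}, G y is (WW_{s,t} - WW_{s,u})(x0, y), the points x0, x1, y0, y1 are
    Y'_s, Y'_u, Y_s, Y_u, and w is W_{s,u}(Y'_s).  The second hypothesis is
    Chen's relation; it replaces the variation of the derivative of f in the
    direction w by variations of G and F, so that no second derivative of f and
    no product of two norms appears.  The variation of F (x0, y0 + x (y1 - y0))
    that this produces is merged with F (x1, y1) - F (x0, y0): what remains is
    F (x1, y1) - F (x0, y0 + x (y1 - y0)), proportional to 1 - x in y1 - y0
    while the variation of G is proportional to x; hence both halves. *)
Lemma germ_defect (V : normedModType R) (f G : V -> V) (F : sumprod V V -> V)
    (x0 x1 y0 y1 w : V) (r s Lf LG LF : R) :
  (forall y, differentiable f y) ->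
  (forall y, G y - F (x0, y) = frechet f y w) ->
  `|x0| <= r -> `|x1| <= r -> `|y0| <= s -> `|y1| <= s ->
  (forall y, `|y| <= s -> `|frechet f y| <= Lf) ->
  (forall y, `|y| <= s -> `|G y - G y0| <= LG * `|y - y0|) ->
  (forall x y, `|x| <= r -> `|y| <= s ->
    `|F (x1, y1) - F (x, y)| <= LF * (`|x1 - x| + `|y1 - y|)) ->
  `|f y0 - f y1 + G y0 - F (x1, y1)| <=
  Lf * `|y1 - y0 - w| + LG / 2 * `|y1 - y0| +
  LF * (`|x1 - x0| + `|y1 - y0| / 2).
Proof.
move=> df chen x0r x1r y0s y1s fL GL FL.
(* c makes the increment of x |-> f (y0 + x dy) + x c over [0, 1] the opposite
   of the defect; A + 2 B x is the affine bound of its derivative. *)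
set dy := y1 - y0; set c := F (x1, y1) - G y0.
pose A := Lf * `|dy - w| + LF * (`|x1 - x0| + `|dy|).
pose B := (LG - LF) * `|dy| / 2.
have := @mean_value_inequality _ _ (fun x : R => f (y0 + x *: dy) + x *: c)
  (fun x => A * x + B * x ^+ 2) (fun x => frechet f (y0 + x *: dy) dy + c)
  (fun x => A + 2 * B * x) 0 1.
rewrite !scale0r !scale1r !addr0 !mulr0 expr0n/= mulr0 expr1n addr0 subr0.
rewrite !mulr1.
have -> : y0 + dy = y1 by rewrite addrC subrK.
have -> : `|f y1 + c - f y0| = `|f y0 - f y1 + G y0 - F (x1, y1)|.
  rewrite -normrN; congr `|_|; rewrite /c !opprD !opprK.
  by rewrite [LHS](AC (1*2*1) (4*1*3*2)).
move=> mvi; apply: le_trans (mvi _ _ _ ler01) _ => [x _|x _|x x01|].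
- apply: is_deriveD; first exact: is_derive_segment.
  exact: is_derive_scalel.
- by apply: is_derive_eq; rewrite /GRing.scale/=; ring.
- have /andP[x0' x1'] := x01.
  have ys := segment_ball y0s y1s x01; rewrite -/dy in ys.
  have -> : frechet f (y0 + x *: dy) dy + c =
    frechet f (y0 + x *: dy) (dy - w) + (G (y0 + x *: dy) - G y0) +
    (F (x1, y1) - F (x0, y0 + x *: dy)).
    have := (clinearP (frechet f (y0 + x *: dy))).1 1 w (dy - w).
    rewrite !scale1r (addrC w) subrK => ->; rewrite -chen /c.
    by rewrite [LHS](AC (2*1*2) (3*(1*5)*(4*2))).
  have b1 : `|frechet f (y0 + x *: dy) (dy - w)| <= Lf * `|dy - w|.
    by rewrite (le_trans (opnorm_le _ _))// ler_wpM2r// fL.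
  have b2 := GL _ ys; rewrite [y0 + _ - y0]addrC addKr normrZ ger0_norm// in b2.
  have b3 := FL _ _ x0r ys.
  have e3 : y1 - (y0 + x *: dy) = (1 - x) *: dy.
    by rewrite opprD addrA scalerBl scale1r.
  rewrite e3 normrZ ger0_norm ?subr_ge0// in b3.
  rewrite (le_trans (ler_normD _ _))// (le_trans (lerD (ler_normD _ _) b3))//.
  rewrite (le_trans (lerD (lerD b1 b2) (lexx _)))// /A /B; lra.
- by rewrite /A /B; lra.
Qed.

End segments.

(** * Partitions and partition sums *)

Section partitions.
Context {R : realType}.
Implicit Types (s t d : R) (p q : seq R).

Lemma partition_sum_nil (V : zmodType) (Xi : R -> R -> V) s :
  partition_sum Xi s [::] = 0.
Proof. by rewrite /partition_sum big_geq. Qed.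

Lemma partition_sum_cons (V : zmodType) (Xi : R -> R -> V) s x p :
  partition_sum Xi s (x :: p) = Xi s x + partition_sum Xi x p.
Proof. by rewrite /partition_sum /= big_nat_recl. Qed.

Lemma partition_sum_cat (V : zmodType) (Xi : R -> R -> V) s p q :
  partition_sum Xi s (p ++ q) =
  partition_sum Xi s p + partition_sum Xi (last s p) q.
Proof.
elim: p s => [|x p ih] s /=; first by rewrite partition_sum_nil add0r.
by rewrite !partition_sum_cons ih addrA.
Qed.

Lemma mesh_cons s x p : mesh s (x :: p) = Num.max (x - s) (mesh x p).
Proof. by rewrite /mesh /= big_nat_recl. Qed.

Lemma mesh_ge0 s p : 0 <= mesh s p.
Proof.
case: p => [|x p]; first by rewrite /mesh big_geq.
elim: p s x => [|y p ih] s x.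
  by rewrite mesh_cons /mesh/= big_geq// le_max lexx orbT.
by rewrite mesh_cons le_max ih orbT.
Qed.

Lemma mesh_cat s p q :
  mesh s (p ++ q) = Num.max (mesh s p) (mesh (last s p) q).
Proof.
elim: p s => [|x p ih] s /=.
  by rewrite {2}/mesh big_geq//; apply/esym/max_idPr/mesh_ge0.
by rewrite !mesh_cons ih maxA.
Qed.

Lemma itv_partition_catP s t p q :
  itv_partition s t (p ++ q) <->
  itv_partition s (last s p) p /\ itv_partition (last s p) t q.
Proof.
rewrite /itv_partition cat_path last_cat; split.
  by move=> [/andP[-> ->] ->].
by move=> [[-> _] [-> ->]].
Qed.

Lemma itv_partition_mem s t p x : itv_partition s t p -> x \in p -> s < x <= t.
Proof.
move=> ip xp; case/splitPr: xp ip => p1 p2.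
rewrite -cat1s catA => /itv_partition_catP[[+ _] /itv_partition_le].
rewrite cats1 last_rcons => /(order_path_min lt_trans)/allP/(_ x).
by rewrite mem_rcons mem_head => /(_ isT)-> ->.
Qed.

(** Refinements are compared interval by interval: a refinement of a partition
    is cut at each point of the coarser one. *)
Lemma itv_partition_split s t p x : itv_partition s t p -> x \in p ->
  exists p1 p2, [/\ p = rcons p1 x ++ p2, itv_partition s x (rcons p1 x) &
                    itv_partition x t p2].
Proof.
move=> ip /splitPr xp; case: xp ip => p1 p2; rewrite -cat_rcons.
by move=> /itv_partition_catP; rewrite last_rcons => -[? ?]; exists p1, p2.
Qed.

(** The interval of the partition that contains the cutting point m; both
    remaining partitions lie on one side of m. *)
Lemma itv_partition_straddle s t p m : itv_partition s t p -> s < m -> m <= t ->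
  exists p1 x p2, p = p1 ++ x :: p2 /\ last s p1 < m <= x.
Proof.
elim: p s => [|x p ih] s ip sm mt.
  by move/itv_partition_nil: ip sm mt => ->; rewrite ltNge => /negP.
have [mx|xm] := leP m x; first by exists [::], x, p; rewrite /= sm.
have [|p1 [y [p2 [-> p1m]]]] := ih x _ xm mt.
  exact: itv_partition_cons ip.
by exists (x :: p1), y, p2.
Qed.

Lemma itv_partition_common s t p q :
  itv_partition s t p -> itv_partition s t q ->
  exists r, [/\ itv_partition s t r, {subset p <= r} & {subset q <= r}].
Proof.
move=> ip iq.
have [st|] := eqVneq s t.
  exists [::]; move: ip iq; rewrite st.
  by move=> /[dup] ? /itv_partitionxx-> /itv_partitionxx->.
move=> st.
pose r := sort <=%R (undup (p ++ q)).
have mr x : (x \in r) = (x \in p) || (x \in q).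
  by rewrite mem_sort mem_undup mem_cat.
have rst x : x \in r -> s < x <= t.
  by rewrite mr => /orP[]; exact: itv_partition_mem.
have tr : t \in r.
  rewrite mr; apply/orP; left; case: p ip {r mr rst} => [|y p].
    by move=> /itv_partition_nil e; rewrite e eqxx in st.
  by move=> [_ /eqP <-]; rewrite /= mem_last.
exists r; split; last 2 first.
- by move=> x xp; rewrite mr xp.
- by move=> x xq; rewrite mr xq orbT.
have sr : path <%R s r.
  rewrite (path_sortedE lt_trans) sort_lt_sorted undup_uniq andbT.
  by apply/allP => x /rst /andP[].
split=> //; rewrite eq_le; apply/andP; split.
  have := mem_last s r; rewrite inE => /orP[/eqP->|/rst/andP[]//].
  by have /andP[/ltW] := rst _ tr.
by have /andP[] := itv_partition_mem (conj sr (eqxx _)) tr.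
Qed.

Lemma exists_mesh_lt s t d : s <= t -> 0 < d ->
  exists p, itv_partition s t p /\ mesh s p < d.
Proof.
move=> st d0; have FF := mesh_filter_proper st.
have : mesh_filter s t [set p | itv_partition s t p /\ mesh s p < d].
  by exists d.
by move=> /filter_ex[p]; exists p.
Qed.

End partitions.

(** * The sewing lemma *)

Lemma powR_half (R : realType) (th h : R) : 0 <= h ->
  2 * (h / 2) `^ th = 2 `^ (1 - th) * h `^ th.
Proof.
move=> h0; rewrite powRM// ?invr_ge0// powRB ?pnatr_eq0 ?implybT// powRr1//.
by rewrite -powRN -mulN1r powRrM powR_inv1//; ring.
Qed.

Section sewing_lemma.
Context {R : realType} {V : normedModType R}.
Variables (a b th : R) (Xi : R -> R -> V).
Hypothesis th1 : 1 < th.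

Let rho : R := 2 `^ (1 - th).

Let th_gt0 : 0 < th. Proof. exact: lt_trans ltr01 th1. Qed.

Lemma geometric_ratio_lt1 : rho < 1.
Proof.
rewrite /rho -opprB powRN invf_lt1 ?powR_gt0//.
rewrite -[ltLHS](powRr0 2) /powR pnatr_eq0/= ltr_expR.
by rewrite ltr_pM2r ?subr_gt0// ln_gt0// ltr1n.
Qed.

(** The contraction behind every estimate below: the errors on two intervals of
    at most half the length add up to rho < 1 times the error allowed on the
    whole. *)
Lemma powR_merge (K x y h : R) : 0 <= K -> 0 <= x <= h / 2 -> 0 <= y <= h / 2 ->
  K * x `^ th + K * y `^ th <= rho * (K * h `^ th).
Proof.
move=> K0 /andP[x0 xh] /andP[y0 yh].
have h0 : 0 <= h by lra.
have th0 := ltW th_gt0.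
have mono z : 0 <= z -> z <= h / 2 -> K * z `^ th <= K * (h / 2) `^ th.
  by move=> z0 zh; rewrite ler_wpM2l// ge0_ler_powR ?nnegrE// divr_ge0.
rewrite (le_trans (lerD (mono _ x0 xh) (mono _ y0 yh)))//.
by rewrite mulrCA -powR_half// -subr_ge0 (_ : _ - _ = 0)//; ring.
Qed.

Section almost_additive.
Variable K : R.
Hypothesis K0 : 0 <= K.
Hypothesis XiK : forall s u t, a <= s -> s <= u -> u <= t -> t <= b ->
  `|Xi s t - Xi s u - Xi u t| <= K * (t - s) `^ th.

Let C : R := 2 * K / (1 - rho).

Let C0 : 0 <= C.
Proof. by rewrite divr_ge0 ?mulr_ge0// subr_ge0 ltW// geometric_ratio_lt1. Qed.

Let CE : rho * C + 2 * K = C.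
Proof.
have h : 1 - rho != 0 by rewrite subr_eq0 gt_eqF// geometric_ratio_lt1.
by rewrite /C; field.
Qed.

Lemma germ_diag s : a <= s -> s <= b -> Xi s s = 0.
Proof.
move=> as_ sb; apply/eqP; rewrite -normr_le0.
have := XiK as_ (lexx _) (lexx _) sb.
by rewrite !subrr sub0r normrN powR0 ?mulr0// gt_eqF.
Qed.

(** A partition is cut at the interval ]u, x] that straddles the midpoint.  The
    two remaining partitions are shorter and of at most half the length, while
    reinserting u and x costs two defects; C solves rho C + 2 K = C. *)
Lemma partition_sum_germ p s t : a <= s -> t <= b -> itv_partition s t p ->
  `|partition_sum Xi s p - Xi s t| <= C * (t - s) `^ th.
Proof.
have [n] := ubnP (size p); elim: n => // n ih in p s t *.
rewrite ltnS => pn as_ tb ip.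
have st := itv_partition_le ip.
have [e|nst] := eqVneq s t.
  rewrite -{}e in ip tb *.
  have -> := itv_partitionxx ip.
  rewrite partition_sum_nil germ_diag// !subrr normr0.
  by rewrite powR0 ?mulr0// gt_eqF.
have lst : s < t by rewrite lt_neqAle nst.
have [||p1 [x [p2 [pE /andP[ltm mx]]]]] :=
    @itv_partition_straddle _ s t p ((s + t) / 2) ip; [lra|lra|].
move: ip pn; rewrite {}pE => /itv_partition_catP[ip1 ip2] pn.
set u := last s p1 in ltm ip1 ip2 *.
have ip3 := itv_partition_cons ip2.
have ux : u < x by have [/andP[]] := ip2.
have su := itv_partition_le ip1.
have xt := itv_partition_le ip3.
have {}ih1 : `|partition_sum Xi s p1 - Xi s u| <= C * (u - s) `^ th.
  apply: ih => //; last by lra.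
  by rewrite (leq_trans _ pn)// size_cat/= addnS ltnS leq_addr.
have {}ih2 : `|partition_sum Xi x p2 - Xi x t| <= C * (t - x) `^ th.
  apply: ih => //; last by lra.
  by rewrite (leq_trans _ pn)// size_cat/= addnS ltnS leq_addl.
have d1 : `|Xi s t - Xi s u - Xi u t| <= K * (t - s) `^ th.
  by apply: XiK => //; lra.
have d2 : `|Xi u t - Xi u x - Xi x t| <= K * (t - s) `^ th.
  apply: le_trans (_ : K * (t - u) `^ th <= _); first by apply: XiK => //; lra.
  rewrite ler_wpM2l// ge0_ler_powR ?nnegrE ?(ltW th_gt0)//; lra.
have := @powR_merge C (u - s) (t - x) (t - s) C0.
have -> : partition_sum Xi s (p1 ++ x :: p2) - Xi s t =
   (partition_sum Xi s p1 - Xi s u) + (partition_sum Xi x p2 - Xi x t)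
   - (Xi s t - Xi s u - Xi u t) - (Xi u t - Xi u x - Xi x t).
  rewrite partition_sum_cat partition_sum_cons -/u.
  rewrite !opprB [RHS](AC (2*2*(1*2)*(1*2)) (1*(9*3)*7*((6*2)*(8*4)*(5*10)))).
  by rewrite /= !subrr !addr0.
move=> merge.
rewrite -CE (le_trans (ler_normB _ _))// (le_trans (lerD (ler_normB _ _) d2))//.
have := ler_normD (partition_sum Xi s p1 - Xi s u)
  (partition_sum Xi x p2 - Xi x t).
have : C * (u - s) `^ th + C * (t - x) `^ th <= rho * (C * (t - s) `^ th).
  by apply: merge; apply/andP; split; lra.
rewrite mulrDl; lra.
Qed.

(** The local errors of [partition_sum_germ] are summable: each is at most
    C d^(th - 1) times the length of its interval, as the mesh is at most d. *)
Lemma partition_sum_refine d p q s t : a <= s -> t <= b ->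
  itv_partition s t p -> itv_partition s t q -> {subset p <= q} ->
  mesh s p <= d ->
  `|partition_sum Xi s q - partition_sum Xi s p| <=
  C * d `^ (th - 1) * (t - s).
Proof.
elim: p q s => [|x p ih] q s as_ tb ip iq pq pd.
  move: (itv_partition_nil ip) iq => -> /itv_partitionxx->.
  by rewrite !subrr normr0 mulr0.
have [q1 [q2 [qE iq1 iq2]]] := itv_partition_split iq (pq _ (mem_head _ _)).
have ip2 := itv_partition_cons ip.
have sx : s < x by have [/andP[]] := ip.
have xt := itv_partition_le ip2.
move: pd; rewrite mesh_cons ge_max => /andP[xd pd].
have pq2 : {subset p <= q2}.
  move=> y yp; have := pq y; rewrite inE yp orbT => /(_ isT).
  rewrite qE mem_cat => /orP[/(itv_partition_mem iq1)/andP[_ yx]|//].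
  by have /andP[/lt_geF] := itv_partition_mem ip2 yp; rewrite yx.
have {}ih := ih q2 x (le_trans as_ (ltW sx)) tb ip2 iq2 pq2 pd.
have head := partition_sum_germ as_ (le_trans xt tb) iq1.
have -> : partition_sum Xi s q - partition_sum Xi s (x :: p) =
    (partition_sum Xi s (rcons q1 x) - Xi s x) +
    (partition_sum Xi x q2 - partition_sum Xi x p).
  by rewrite qE partition_sum_cat last_rcons partition_sum_cons opprD addrACA.
rewrite (le_trans (ler_normD _ _))//.
have : C * (x - s) `^ th <= C * d `^ (th - 1) * (x - s).
  rewrite -(@mulr_powRB1 _ (x - s))//; last by lra.
  rewrite mulrCA mulrC ler_wpM2r//; first by lra.
  by rewrite ler_wpM2l// ge0_ler_powR ?nnegrE ?subr_ge0 ?(ltW th1)//; lra.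
lra.
Qed.

End almost_additive.
End sewing_lemma.

Section sewing_theorem.
Context {R : realType} {V : completeNormedModType R}.
Variables (a b th : R) (Xi : R -> R -> V).
Hypothesis th1 : 1 < th.
Variable K : R.
Hypothesis K0 : 0 <= K.
Hypothesis XiK : forall s u t, a <= s -> s <= u -> u <= t -> t <= b ->
  `|Xi s t - Xi s u - Xi u t| <= K * (t - s) `^ th.

(** Two partitions of small mesh are compared through a common refinement. *)
Theorem partition_sum_cvg s t : a <= s -> s <= t -> t <= b ->
  cvg (partition_sum Xi s p @[p --> mesh_filter s t]).
Proof.
move=> as_ st tb; have FF := mesh_filter_proper st.
set C := 2 * K / (1 - 2 `^ (1 - th)).
have C0 : 0 <= C.
  by rewrite divr_ge0 ?mulr_ge0// subr_ge0 ltW// geometric_ratio_lt1.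
apply: cauchy_cvg; apply: cauchy_exP => e e0.
pose c := 2 * (C * (t - s)) + 1.
have Cts : 0 <= C * (t - s) by rewrite mulr_ge0// subr_ge0.
have c0 : 0 < c by rewrite /c; lra.
(* c d^(th - 1) = e, and twice the refinement error at mesh d is less than
   c d^(th - 1). *)
pose d := (e / c) `^ (th - 1)^-1.
have d0 : 0 < d by rewrite powR_gt0// divr_gt0.
have dE : d `^ (th - 1) = e / c.
  rewrite -powRrM mulVf ?powRr1 ?divr_ge0 ?(ltW e0) ?(ltW c0)//.
  by rewrite subr_eq0 gt_eqF.
have [p0 [ip0 mp0]] := exists_mesh_lt st d0.
exists (partition_sum Xi s p0), d => // p [ip mp].
have [q [iq p0q pq]] := itv_partition_common ip0 ip.
have r0 := partition_sum_refine th1 K0 XiK as_ tb ip0 iq p0q (ltW mp0).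
have r1 := partition_sum_refine th1 K0 XiK as_ tb ip iq pq (ltW mp).
rewrite -ball_normE /ball_/=.
have -> : partition_sum Xi s p0 - partition_sum Xi s p =
  (partition_sum Xi s q - partition_sum Xi s p) -
  (partition_sum Xi s q - partition_sum Xi s p0).
  by rewrite opprB [RHS]addrC addrA subrK.
rewrite (le_lt_trans (ler_normB _ _))// (le_lt_trans (lerD r1 r0))//.
rewrite -/C dE -mulrA mulrCA -mulrDr -mulrDr -mulr2n -mulr_natl.
rewrite mulrAC -mulrA gtr_pMr// ltr_pdivrMr// mul1r /c; lra.
Qed.

Fixpoint dyadic (n : nat) (s t : R) : seq R :=
  if n is n'.+1 then dyadic n' s ((s + t) / 2) ++ dyadic n' ((s + t) / 2) t
  else [:: t].

Lemma dyadic_partition n s t : s < t ->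
  itv_partition s t (dyadic n s t) /\ mesh s (dyadic n s t) <= (t - s) / 2 ^+ n.
Proof.
elim: n s t => [|n ih] s t st /=.
  split; first exact: itv_partition1.
  by rewrite mesh_cons /mesh big_geq//= expr0 divr1 ge_max lexx subr_ge0 ltW.
have [|i1 m1] := ih s ((s + t) / 2); first lra.
have [|i2 m2] := ih ((s + t) / 2) t; first lra.
split; first exact: itv_partition_cat i1 i2.
have half (x : R) : x / 2 / 2 ^+ n = x / 2 ^+ n.+1.
  by rewrite -mulrA -invfM -exprS.
case: (i1) => _ /eqP l1; rewrite mesh_cat l1 ge_max -half.
rewrite (le_trans m1) ?(le_trans m2)// ler_wpM2r ?invr_ge0 ?exprn_ge0//; lra.
Qed.

Variable K' : R.
Hypothesis K'0 : 0 <= K'.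
Hypothesis XiK' : forall s t, a <= s -> s <= t -> t <= b ->
  `|Xi s t - Xi s ((s + t) / 2) - Xi ((s + t) / 2) t| <= K' * (t - s) `^ th.

Let k : R := (1 - 2 `^ (1 - th))^-1.

(** Halving an interval costs one midpoint defect, and k satisfies
    rho k + 1 = k for the contraction factor rho = 2^(1 - th); so the bound
    K' k reproduces itself at each dyadic level. *)
Lemma dyadic_sum_germ n s t : a <= s -> s < t -> t <= b ->
  `|partition_sum Xi s (dyadic n s t) - Xi s t| <= K' * k * (t - s) `^ th.
Proof.
have rho1 := geometric_ratio_lt1 th1.
have k0 : 0 <= k by rewrite invr_ge0 subr_ge0 ltW.
have Kk0 : 0 <= K' * k by rewrite mulr_ge0.
have kE : 2 `^ (1 - th) * (K' * k) + K' = K' * k.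
  have h : 1 - 2 `^ (1 - th) != 0 by rewrite subr_eq0 gt_eqF.
  by rewrite /k; field.
elim: n s t => [|n ih] s t as_ st tb /=.
  rewrite partition_sum_cons partition_sum_nil addr0 subrr normr0.
  by rewrite mulr_ge0 ?powR_ge0.
set m := (s + t) / 2.
have [sm mt] : s < m /\ m < t by rewrite /m; split; lra.
have ih1 := ih s m as_ sm (le_trans (ltW mt) tb).
have ih2 := ih m t (le_trans as_ (ltW sm)) mt tb.
have d := XiK' as_ (ltW st) tb; rewrite -/m in d.
have [[_ /eqP l1] _] := dyadic_partition n sm.
have -> : partition_sum Xi s (dyadic n s m ++ dyadic n m t) - Xi s t =
   (partition_sum Xi s (dyadic n s m) - Xi s m) +
   (partition_sum Xi m (dyadic n m t) - Xi m t) - (Xi s t - Xi s m - Xi m t).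
  rewrite partition_sum_cat l1 !opprB.
  rewrite [RHS](AC (2*2*(1*2)) (1*3*7*((2*6)*(4*5)))) /=.
  by rewrite (addrC (- Xi s m)) (addrC (- Xi m t)) !subrr !addr0.
rewrite (le_trans (ler_normB _ _))// (le_trans (lerD (ler_normD _ _) d))//.
rewrite (le_trans (lerD (lerD ih1 ih2) (lexx _)))//.
rewrite -[in leRHS]kE mulrDl lerD2r -[leRHS]mulrA.
apply: (powR_merge th1) => //; apply/andP; split; rewrite /m; lra.
Qed.

(** The limit exists by [partition_sum_cvg], so it can be computed along dyadic
    partitions, which only see the midpoint constant K'. *)
Theorem sewing_germ s t : a <= s -> s <= t -> t <= b ->
  `|sewing Xi s t - Xi s t| <= K' * k * (t - s) `^ th.
Proof.
move=> as_ st tb.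
have c := partition_sum_cvg as_ st tb; have FF := mesh_filter_proper st.
apply/ler_addgt0Pr => e e0.
have := c; move/cvgrPdist_lt => /(_ _ e0); rewrite -/(sewing Xi s t).
move=> [d /= d0 pd].
suff [p [ip mp pX]] : exists p, [/\ itv_partition s t p, mesh s p < d &
    `|partition_sum Xi s p - Xi s t| <= K' * k * (t - s) `^ th].
  have /= /ltW pe := pd p (conj ip mp).
  rewrite -[sewing _ _ _](subrK (partition_sum Xi s p)) -addrA.
  by rewrite (le_trans (ler_normD _ _))// [leRHS]addrC lerD.
(* For s = t the empty partition is the only one, and dyadic subdivision does
   not apply. *)
have [e1|nst] := eqVneq s t.
  rewrite e1; exists [::]; split; [by split|by rewrite /mesh big_geq|].
  have sb := le_trans st tb; rewrite partition_sum_nil -e1 subrr.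
  rewrite (germ_diag th1 XiK as_ sb) subrr normr0 powR0 ?mulr0//.
  by rewrite gt_eqF// (lt_trans ltr01).
have lst : s < t by rewrite lt_neqAle nst.
have [n nd] : exists n, (t - s) / 2 ^+ n < d.
  exists (Num.truncn ((t - s) / d)).+1.
  rewrite ltr_pdivrMr ?exprn_gt0// mulrC -ltr_pdivrMr//.
  rewrite (lt_trans (truncnS_gt _))// -natrX ltr_nat.
  exact: ltn_expl.
have [ip mp] := dyadic_partition n lst.
exists (dyadic n s t); split=> //; first exact: le_lt_trans nd.
exact: dyadic_sum_germ.
Qed.

End sewing_theorem.

(** * Pointwise bounds from the norms *)

Section suprema.
Context {R : realType}.

(** Membership of x in P makes every supremum nonnegative, so one summand of
    the finite total norm is dominated by the total. *)
Lemma le_fine_sum_ereal_sup (I : finType) (X : Type) (P : set X)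
    (f : I -> X -> R) (i : I) (x : X) :
  (forall j y, 0 <= f j y) ->
  (\sum_j ereal_sup [set (f j y)%:E | y in P] < +oo)%E -> P x ->
  f i x <= fine (\sum_j ereal_sup [set (f j y)%:E | y in P])%E.
Proof.
move=> f0 + Px; set S := (\sum_j _)%E => Soo.
have sup_ge0 j : (0 <= ereal_sup [set (f j y)%:E | y in P])%E.
  apply: le_trans (ereal_sup_ubound _); last by exists x; [exact: Px|].
  by rewrite lee_fin.
have S0 : (0 <= S)%E by apply: sume_ge0.
rewrite -lee_fin fineK ?ge0_fin_numE//.
apply: (@le_trans _ _ (ereal_sup [set (f i y)%:E | y in P])).
  by apply: ereal_sup_ubound; exists x.
by rewrite /S (bigD1 i)//= leeDl// sume_ge0.
Qed.

Lemma le_fine_ereal_sup (X : Type) (P : set X) (f : X -> R) (x : X) :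
  (forall y, 0 <= f y) ->
  (ereal_sup [set (f y)%:E | y in P] < +oo)%E -> P x ->
  f x <= fine (ereal_sup [set (f y)%:E | y in P]).
Proof.
move=> f0 foo Px.
have := @le_fine_sum_ereal_sup unit X P (fun=> f) tt x.
by rewrite big_const card_unit /= adde0; apply.
Qed.

End suprema.

Section seminorm_bounds.
Context {R : realType} {V : normedModType R}.
Variable T : R.
Hypothesis T0 : 0 < T.

Lemma enorm2_le (g : R) (F : R -> R -> V) (s t : R) :
  (enorm2 T g F < +oo)%E -> 0 <= s <= T -> 0 <= t <= T -> s != t ->
  `|F s t| <= fine (enorm2 T g F) * `|t - s| `^ g.
Proof.
move=> Foo sT tT st.
rewrite -ler_pdivrMr; last by rewrite powR_gt0// normr_gt0 subr_eq0 eq_sym.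
apply: (@le_fine_ereal_sup _ _ (time_pairs T)
  (fun p : R * R => `|F p.1 p.2| / `|p.2 - p.1| `^ g) (s, t)) => //.
Qed.

Lemma enorm2_ge0 (g : R) (F : R -> R -> V) :
  (enorm2 T g F < +oo)%E -> 0 <= fine (enorm2 T g F).
Proof.
move=> Foo.
have T01 : 0 <= (0 : R) <= T by rewrite lexx ltW.
have T11 : 0 <= T <= T by rewrite lexx ltW.
have := enorm2_le Foo T01 T11; rewrite lt_eqF// => /(_ isT).
move=> /(le_trans (normr_ge0 _)); rewrite pmulr_lge0//.
by rewrite powR_gt0// normr_gt0 subr0 gt_eqF.
Qed.

Lemma holder_enorm_oo (a : R) (Y : R -> V) : 0 <= a ->
  holder_space T a Y -> (enorm_oo T Y < +oo)%E.
Proof.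
move=> a0 Ya; have H0 := enorm2_ge0 Ya.
apply: (@le_lt_trans _ _ (`|Y 0| + fine (enorm_holder T a Y) * T `^ a)%:E);
  last by rewrite ltry.
apply: ge_ereal_sup => _ [t /= t01 <-]; rewrite lee_fin.
have T0T : 0 <= T `^ a by rewrite powR_ge0.
have [->|t0] := eqVneq t 0; first by rewrite lerDl mulr_ge0.
have T01 : 0 <= (0 : R) <= T by rewrite lexx ltW.
have := enorm2_le Ya T01 t01; rewrite eq_sym t0 subr0 => /(_ isT) Yt.
have -> : Y t = Y 0 + incr Y 0 t by rewrite /incr addrC subrK.
rewrite (le_trans (ler_normD _ _))// lerD2l (le_trans Yt)// ler_wpM2l//.
by case/andP: t01 => t01 tT; rewrite ger0_norm// ge0_ler_powR ?nnegrE// ltW.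
Qed.

Lemma enorm_oo_le (Y : R -> V) (t : R) : (enorm_oo T Y < +oo)%E ->
  0 <= t <= T -> `|Y t| <= fine (enorm_oo T Y).
Proof.
by move=> Yoo tT; apply: (@le_fine_ereal_sup _ _ _ (fun t => `|Y t|)).
Qed.

Lemma enorm_field_le (a : R) (n : nat) (b : nat -> R) (Phi : R -> V -> V)
    (k : nat) (s t : R) (y : V) :
  field_space T a n b Phi -> (k <= n)%N ->
  0 <= s <= T -> 0 <= t <= T -> s != t ->
  `|iter_frechet k (incr Phi s t) y| <=
  fine (enorm_field T a n b Phi) * (`|t - s| `^ a * (1 + `|y|) `^ b k).
Proof.
move=> [_ Poo] kn sT tT st.
have w y' : 0 < 1 + `|y'| :> R by rewrite ltr_wpDr.
rewrite -ler_pdivrMr; last first.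
  by rewrite mulr_gt0 ?powR_gt0// normr_gt0 subr_eq0 eq_sym.
have := @le_fine_sum_ereal_sup _ 'I_n.+1 _ (time_pairs T `*` [set: V])
  (fun k q => `|iter_frechet k (incr Phi q.1.1 q.1.2) q.2| /
                    (`|q.1.2 - q.1.1| `^ a * (1 + `|q.2|) `^ b k))
  (Ordinal (kn : (k < n.+1)%N)) ((s, t), y).
by apply=> //= j q; rewrite divr_ge0 ?mulr_ge0 ?powR_ge0.
Qed.

Lemma enorm_field2_le (g : R) (m : nat) (b1 b2 : nat -> R)
    (Psi : R -> R -> sumprod V V -> V) (k : nat) (s t : R) (p : sumprod V V) :
  field_space2 T g m b1 b2 Psi -> (k <= m)%N ->
  0 <= s <= T -> 0 <= t <= T -> s != t ->
  `|iter_frechet k (Psi s t) p| <= fine (enorm_field2 T g m b1 b2 Psi) *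
    (`|t - s| `^ g * (1 + `|p.1|) `^ b1 k * (1 + `|p.2|) `^ b2 k).
Proof.
move=> [_ Poo] kn sT tT st.
have w y' : 0 < 1 + `|y'| :> R by rewrite ltr_wpDr.
rewrite -ler_pdivrMr; last first.
  by rewrite !mulr_gt0 ?powR_gt0// normr_gt0 subr_eq0 eq_sym.
have := @le_fine_sum_ereal_sup _ 'I_m.+1 _ (time_pairs T `*` [set: sumprod V V])
  (fun k q => `|iter_frechet k (Psi q.1.1 q.1.2) q.2| /
     (`|q.1.2 - q.1.1| `^ g * (1 + `|q.2.1|) `^ b1 k * (1 + `|q.2.2|) `^ b2 k))
  (Ordinal (kn : (k < m.+1)%N)) ((s, t), p).
by apply=> //= j q; rewrite divr_ge0 ?mulr_ge0 ?powR_ge0.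
Qed.

End seminorm_bounds.

Lemma bstar1 (R : realType) (b : nat -> R) :
  bstar b 1 = Num.max (b 0%N) (b 1%N).
Proof.
by rewrite /bstar !big_ord_recl big_ord0/= [Num.max (b 1%N) _]maxC maxA maxxx.
Qed.

Lemma weight_le (R : realType) (x c e e' : R) : 0 <= x -> x <= c ->
  0 <= e -> e <= e' -> (1 + x) `^ e <= (1 + 2 * c) `^ e'.
Proof.
move=> x0 xc e0 ee'.
apply: (@le_trans _ _ ((1 + 2 * c) `^ e)).
  by apply: ge0_ler_powR; rewrite ?nnegrE//; lra.
by apply: ler_powR => //; lra.
Qed.

(** * The defect of the nonlinear rough germ *)

Lemma powR_cube (R : realType) (x a : R) : x `^ (3 * a) = (x `^ a) ^+ 3.
Proof. by rewrite mulrC powRrM powR_mulrn ?powR_ge0. Qed.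

(** The term of W carries only the weight B; it is majorised by giving it the
    weight A >= 1 as well, so that one product bounds all three terms. *)
Lemma weighted_const_le (R : realType) (M N A B Hy Hd Hr : R) :
  0 <= M -> 0 <= N -> 1 <= A -> 0 <= B -> 0 <= Hy -> 0 <= Hd -> 0 <= Hr ->
  M * B * Hr + N * A * B * Hd + N * A * B * Hy <=
  (M + N) * A * B * (Hy + Hd + Hr).
Proof.
move=> M0 N0 A1 B0 Hy0 Hd0 Hr0.
have A0 : 0 <= A by rewrite (le_trans ler01).
have MBA : M * B * Hr <= M * B * A * Hr.
  by rewrite ler_wpM2r// ler_peMr ?mulr_ge0.
have q2 : 0 <= M * B * A * (Hy + Hd) by rewrite !mulr_ge0 ?addr_ge0.
have q3 : 0 <= N * A * B * Hr by rewrite !mulr_ge0.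
lra.
Qed.

Section rough_germ.
Context {R : realType} {V : normedModType R}.
Variables (T a : R) (b : nat -> R).
Hypotheses (T0 : 0 < T) (a0 : 0 < a).
Hypotheses (b0 : 0 <= b 0%N) (b1 : 0 <= b 1%N).
Variables (W : R -> V -> V) (WW : R -> R -> sumprod V V -> V).
Hypothesis hW : nl_rough_path T a 2 b W WW.
Variables Y dY : R -> V.
Hypothesis hY : controlled T a W Y dY.

Definition rough_germ (s t : R) : V := incr W s t (Y s) + WW s t (dY s, Y s).

Definition rough_const : R :=
  norm_rough_path T a 2 b W WW *
  (1 + 2 * fine (enorm_oo T dY)) `^ Num.max (b 0%N) (b 1%N) *
  (1 + 2 * fine (enorm_oo T Y)) `^ Num.max (b 1%N) (b 2%N) *
  (fine (enorm_holder T a Y) + fine (enorm_holder T a dY) +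
   fine (enorm2 T (2 * a) (remainder W Y dY))).

Let M := fine (enorm_field T a 2 b W).
Let N := fine (enorm_field2 T (2 * a) 1 (bstar b) (bstar2 b) WW).
Let A := (1 + 2 * fine (enorm_oo T dY)) `^ Num.max (b 0%N) (b 1%N).
Let B := (1 + 2 * fine (enorm_oo T Y)) `^ Num.max (b 1%N) (b 2%N).
Let Hy := fine (enorm_holder T a Y).
Let Hd := fine (enorm_holder T a dY).
Let Hr := fine (enorm2 T (2 * a) (remainder W Y dY)).

Let hWW : field_space2 T (2 * a) 1 (bstar b) (bstar2 b) WW.
Proof. by case: hW. Qed.

Let hW1 : field_space T a 2 b W. Proof. by case: hW. Qed.

Let Yoo : (enorm_oo T Y < +oo)%E.
Proof. by case: hY => Ya _ _; apply: (holder_enorm_oo T0 (ltW a0) Ya). Qed.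
Let dYoo : (enorm_oo T dY < +oo)%E.
Proof. by case: hY => _ Ya _; apply: (holder_enorm_oo T0 (ltW a0) Ya). Qed.

Let time00 : 0 <= (0 : R) <= T. Proof. by rewrite lexx ltW. Qed.
Let timeTT : 0 <= T <= T. Proof. by rewrite lexx ltW. Qed.

Let M0 : 0 <= M.
Proof.
have := enorm_field_le 0 hW1 (leq0n 2) time00 timeTT.
rewrite lt_eqF// => /(_ isT)/(le_trans (normr_ge0 _)); rewrite pmulr_lge0//.
by rewrite mulr_gt0 ?powR_gt0 ?ltr_wpDr// normr_gt0 subr0 gt_eqF.
Qed.

Let N0 : 0 <= N.
Proof.
have := enorm_field2_le 0 hWW (leq0n 1) time00 timeTT.
rewrite lt_eqF// => /(_ isT)/(le_trans (normr_ge0 _)); rewrite pmulr_lge0//.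
by rewrite !mulr_gt0 ?powR_gt0 ?ltr_wpDr// normr_gt0 subr0 gt_eqF.
Qed.

Let A1 : 1 <= A.
Proof.
have d0 : 0 <= fine (enorm_oo T dY).
  exact: le_trans (normr_ge0 _) (enorm_oo_le dYoo time00).
rewrite -[leLHS](powRr0 (1 + 2 * fine (enorm_oo T dY))).
by apply: ler_powR; [lra|rewrite le_max b0].
Qed.

Let B0 : 0 <= B. Proof. exact: powR_ge0. Qed.

Let Hy0 : 0 <= Hy. Proof. by case: hY => h _ _; exact: (enorm2_ge0 T0 h). Qed.
Let Hd0 : 0 <= Hd. Proof. by case: hY => _ h _; exact: (enorm2_ge0 T0 h). Qed.
Let Hr0 : 0 <= Hr. Proof. by case: hY => _ _ h; exact: (enorm2_ge0 T0 h). Qed.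

Lemma rough_constE : rough_const = (M + N) * A * B * (Hy + Hd + Hr).
Proof. by []. Qed.

Lemma rough_const_ge0 : 0 <= rough_const.
Proof.
have A0 : 0 <= A by exact: powR_ge0.
rewrite rough_constE; apply: mulr_ge0; last by rewrite !addr_ge0.
by apply: mulr_ge0 => //; apply: mulr_ge0 => //; exact: addr_ge0.
Qed.

Let frechet_field_le s t y : 0 <= s <= T -> 0 <= t <= T -> s != t ->
  `|y| <= fine (enorm_oo T Y) ->
  `|frechet (incr W s t) y| <= M * `|t - s| `^ a * B.
Proof.
move=> sT tT st yY.
have := enorm_field_le (k := 1) y hW1 isT sT tT st.
move=> /le_trans; apply; rewrite -mulrA ler_wpM2l// ler_wpM2l ?powR_ge0//.
by apply: weight_le => //; rewrite le_max lexx.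
Qed.

Let frechet_field2_le s t (p : sumprod V V) :
  0 <= s <= T -> 0 <= t <= T -> s != t ->
  `|p.1| <= fine (enorm_oo T dY) -> `|p.2| <= fine (enorm_oo T Y) ->
  `|frechet (WW s t) p| <= N * `|t - s| `^ (2 * a) * A * B.
Proof.
move=> sT tT st p1 p2.
have := enorm_field2_le (k := 1) p hWW isT sT tT st.
move=> /le_trans; apply; rewrite -!mulrA ler_wpM2l// ler_wpM2l ?powR_ge0//.
apply: ler_pM; rewrite ?powR_ge0//; apply: weight_le => //.
- by rewrite bstar1 le_max b0.
- by rewrite bstar1.
- by rewrite /bstar2 bstar1 le_max b1.
- by rewrite /bstar2 bstar1.
Qed.

Let field2_lipschitz s t (p q : sumprod V V) :
  0 <= s <= T -> 0 <= t <= T -> s != t ->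
  `|p.1| <= fine (enorm_oo T dY) -> `|p.2| <= fine (enorm_oo T Y) ->
  `|q.1| <= fine (enorm_oo T dY) -> `|q.2| <= fine (enorm_oo T Y) ->
  `|WW s t q - WW s t p| <=
  N * `|t - s| `^ (2 * a) * A * B * (`|q.1 - p.1| + `|q.2 - p.2|).
Proof.
move=> sT tT st p1 p2 q1 q2.
apply: (@frechet_lipschitz _ _ _ (WW s t) p q) => [x|x x01].
  by case: hWW => /(_ s t sT tT)[/(_ 0%N isT x)].
by apply: frechet_field2_le => //; exact: segment_ball.
Qed.

(** Both uses, midpoints and arbitrary u, differ only in how the powers sg, ta
    of the two subintervals compare with the power h of the whole; the three
    hypotheses are the coefficients of the norms of R, Y' and Y.  The weights at
    the points of the segment from Y_s to Y_u are bounded through the sup norm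
    of Y, by convexity. *)
Lemma rough_germ_defect s u t k (sg := (u - s) `^ a) (ta := (t - u) `^ a)
    (h := (t - s) `^ a) : 0 <= s -> s < u -> u < t -> t <= T ->
  ta * sg ^+ 2 <= k * h ^+ 3 -> ta ^+ 2 * sg <= k * h ^+ 3 ->
  ((h ^+ 2 + sg ^+ 2) * sg + ta ^+ 2 * sg) / 2 <= k * h ^+ 3 ->
  `|rough_germ s t - rough_germ s u - rough_germ u t| <=
  rough_const * (k * h ^+ 3).
Proof.
move=> s0 su ut tT k1 k2 k3.
have sI : 0 <= s <= T by apply/andP; split; lra.
have uI : 0 <= u <= T by apply/andP; split; lra.
have tI : 0 <= t <= T by apply/andP; split; lra.
have st : s < t by lra.
have sq x : x `^ (2 * a) = (x `^ a) ^+ 2.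
  by rewrite -powR_mulrn ?powR_ge0// -powRrM mulrC.
have -> : rough_germ s t - rough_germ s u - rough_germ u t =
  incr W u t (Y s) - incr W u t (Y u) +
  (WW s t (dY s, Y s) - WW s u (dY s, Y s)) - WW u t (dY u, Y u).
  have inc x : incr W s t x = incr W s u x + incr W u t x.
    by rewrite /incr !fctE [RHS]addrC addrA subrK.
  rewrite /rough_germ inc.
  move: (incr W s u (Y s)) (incr W u t (Y s)) (incr W u t (Y u)) => p q r.
  rewrite !opprD [LHS](AC (3*2*2) (1*4*(2*6*(3*5)*7))) /=.
  by rewrite subrr add0r.
have := @germ_defect _ _ (incr W u t)
  (fun y => WW s t (dY s, y) - WW s u (dY s, y)) (WW u t)
  (dY s) (dY u) (Y s) (Y u) (incr W s u (dY s))
  (fine (enorm_oo T dY)) (fine (enorm_oo T Y))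
  (M * ta * B) (N * (h ^+ 2 + sg ^+ 2) * A * B) (N * ta ^+ 2 * A * B).
move=> gd; apply: le_trans (gd _ _ _ _ _ _ _ _ _) _ => {gd}.
- move=> y; apply: differentiableB.
  + by case: hW1 => /(_ t tI)[/(_ 0%N isT y)].
  + by case: hW1 => /(_ u uI)[/(_ 0%N isT y)].
- by move=> y; case: hW => _ _ /(_ (dY s) y s u t sI uI tI).
- exact: enorm_oo_le.
- exact: enorm_oo_le.
- exact: enorm_oo_le.
- exact: enorm_oo_le.
- move=> y yY; have := frechet_field_le uI tI _ yY.
  by rewrite gtr0_norm ?subr_gt0// lt_eqF//; apply.
- move=> y yY.
  have l1 := @field2_lipschitz s t (dY s, Y s) (dY s, y) sI tI.
  have l2 := @field2_lipschitz s u (dY s, Y s) (dY s, y) sI uI.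
  move: l1 l2; rewrite !lt_eqF//= !enorm_oo_le// yY subrr normr0 add0r !sq.
  rewrite !gtr0_norm ?subr_gt0//.
  move=> /(_ isT isT isT isT isT) l1 /(_ isT isT isT isT isT) l2.
  rewrite opprD addrACA -opprD (le_trans (ler_normB _ _))//.
  rewrite (le_trans (lerD l1 l2))// -subr_ge0 (_ : _ - _ = 0)//.
  by rewrite -/h -/sg; ring.
- move=> x y xr yr.
  have := @field2_lipschitz u t (x, y) (dY u, Y u) uI tI.
  rewrite lt_eqF//= !enorm_oo_le// sq gtr0_norm ?subr_gt0//.
  by apply.
have e1 : `|Y u - Y s - incr W s u (dY s)| <= Hr * sg ^+ 2.
  case: hY => _ _ /enorm2_le/(_ sI uI).
  rewrite lt_eqF// sq gtr0_norm ?subr_gt0//.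
  by apply.
have e2 : `|Y u - Y s| <= Hy * sg.
  case: hY => /enorm2_le/(_ sI uI); rewrite lt_eqF// gtr0_norm ?subr_gt0//.
  by move=> /(_ isT).
have e3 : `|dY u - dY s| <= Hd * sg.
  case: hY => _ /enorm2_le/(_ sI uI); rewrite lt_eqF// gtr0_norm ?subr_gt0//.
  by move=> /(_ isT).
rewrite rough_constE; set H := k * h ^+ 3 in k1 k2 k3 *.
have sg0 : 0 <= sg by exact: powR_ge0.
have ta0 : 0 <= ta by exact: powR_ge0.
have h0 : 0 <= h by exact: powR_ge0.
have H0 : 0 <= H by rewrite (le_trans _ k1)// mulr_ge0 ?exprn_ge0.
have A0 : 0 <= A by rewrite (le_trans ler01).
pose e := N * A * B.
have e0 : 0 <= e by rewrite !mulr_ge0.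
have MB0 : 0 <= M * B by rewrite mulr_ge0.
apply: (@le_trans _ _ (M * B * Hr * (ta * sg ^+ 2) + e * Hd * (ta ^+ 2 * sg) +
    e * Hy * (((h ^+ 2 + sg ^+ 2) * sg + ta ^+ 2 * sg) / 2))).
  have t1 : M * ta * B * `|Y u - Y s - incr W s u (dY s)| <=
      M * ta * B * (Hr * sg ^+ 2) by rewrite ler_wpM2l ?mulr_ge0.
  have t2 : N * (h ^+ 2 + sg ^+ 2) * A * B / 2 * `|Y u - Y s| <=
      N * (h ^+ 2 + sg ^+ 2) * A * B / 2 * (Hy * sg).
    by rewrite ler_wpM2l ?mulr_ge0 ?addr_ge0 ?exprn_ge0// invr_ge0.
  have t3 : N * ta ^+ 2 * A * B * (`|dY u - dY s| + `|Y u - Y s| / 2) <=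
      N * ta ^+ 2 * A * B * (Hd * sg + Hy * sg / 2).
    rewrite ler_wpM2l ?mulr_ge0 ?exprn_ge0//; lra.
  rewrite (le_trans (lerD (lerD t1 t2) t3))// -subr_ge0 (_ : _ - _ = 0)//.
  by rewrite /e; field.
apply: (@le_trans _ _ ((M * B * Hr + e * Hd + e * Hy) * H)).
  rewrite [leRHS]mulrDl [X in _ <= X + _]mulrDl.
  by apply: lerD; [apply: lerD|]; apply: ler_wpM2l => //; rewrite mulr_ge0.
rewrite ler_wpM2r//.
exact: weighted_const_le.
Qed.

Lemma rough_germ_diag s : 0 <= s <= T -> rough_germ s s = 0.
Proof.
move=> sT; rewrite /rough_germ /incr fctE subrr add0r.
case: hW => _ _ /(_ (dY s) (Y s) s s s sT sT sT).
rewrite subrr sub0r {2}/incr fctE subrr => WW0.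
apply/eqP; rewrite -oppr_eq0 WW0 -normr_le0.
by rewrite (le_trans (opnorm_le _ _))// normr0 mulr0.
Qed.

(** The coefficient of the norm of Y can exceed 1 when u is near t, hence the
    factor 2; it is harmless, as only the midpoint constant reaches the final
    estimate. *)
Lemma rough_germ_almost_additive s u t : 0 <= s -> s <= u -> u <= t -> t <= T ->
  `|rough_germ s t - rough_germ s u - rough_germ u t| <=
  rough_const * 2 * (t - s) `^ (3 * a).
Proof.
move=> s0; rewrite le_eqVlt => /predU1P[<- st tT|su].
  rewrite rough_germ_diag ?s0 ?(le_trans st)//.
  rewrite subr0 subrr normr0 mulr_ge0 ?powR_ge0//.
  by rewrite mulr_ge0// rough_const_ge0.
rewrite le_eqVlt => /predU1P[<- uT|ut tT].
  rewrite (@rough_germ_diag u) ?uT ?(le_trans s0 (ltW su))//.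
  rewrite subr0 subrr normr0 mulr_ge0 ?powR_ge0//.
  by rewrite mulr_ge0// rough_const_ge0.
rewrite -mulrA powR_cube.
have sg0 : 0 <= (u - s) `^ a by exact: powR_ge0.
have ta0 : 0 <= (t - u) `^ a by exact: powR_ge0.
have sgh : (u - s) `^ a <= (t - s) `^ a.
  by apply: ge0_ler_powR; rewrite ?nnegrE ?(ltW a0)//; lra.
have tah : (t - u) `^ a <= (t - s) `^ a.
  by apply: ge0_ler_powR; rewrite ?nnegrE ?(ltW a0)//; lra.
apply: rough_germ_defect => //.
all: move: sg0 ta0 sgh tah; set x := (u - s) `^ a; set y := (t - u) `^ a.
all: set h := (t - s) `^ a => x0 y0 xh yh.
all: have m p q r : 0 <= p <= h -> 0 <= q <= h -> 0 <= r <= h ->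
  p * q * r <= h ^+ 3 by move=> /andP[? ?] /andP[? ?] /andP[? ?];
  rewrite 2!exprSr expr1 !ler_pM ?mulr_ge0.
all: have h3 : 0 <= h ^+ 3 by rewrite exprn_ge0// (le_trans x0).
all: have xI : 0 <= x <= h by rewrite x0.
all: have yI : 0 <= y <= h by rewrite y0.
all: have hI : 0 <= h <= h by rewrite (le_trans x0)/=.
- have := m y x x yI xI xI; lra.
- have := m y y x yI yI xI; lra.
- have := m h h x hI hI xI; have := m x x x xI xI xI; have := m y y x yI yI xI.
  lra.
Qed.

(** With q = 2^-a the coefficients are q^3, q^3 and (q + 2 q^3)/2, all at most
    1 because q <= 1 and q^3 = 2^(-3a) <= 1/2. *)
Lemma rough_germ_midpoint s t : 1 <= 3 * a -> 0 <= s -> s <= t -> t <= T ->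
  `|rough_germ s t - rough_germ s ((s + t) / 2) - rough_germ ((s + t) / 2) t| <=
  rough_const * (t - s) `^ (3 * a).
Proof.
move=> a3 s0; rewrite le_eqVlt => /predU1P[<- sT|st tT].
  have -> : (s + s) / 2 = s by lra.
  rewrite rough_germ_diag ?s0// !subr0 normr0 mulr_ge0 ?powR_ge0//.
  exact: rough_const_ge0.
pose q : R := 2^-1 `^ a.
have q0 : 0 <= q by exact: powR_ge0.
have i2 : (0 < 2^-1 :> R) && (2^-1 <= 1 :> R).
  by rewrite invr_gt0 ltr0n invf_le1 ?ltr0n ?ler1n.
have q1 : q <= 1.
  by rewrite -[leRHS](powRr0 2^-1); apply: ger_powR => //; exact: ltW.
have q3 : q ^+ 3 <= 2^-1.
  by rewrite -powR_cube; apply: ge1r_powR.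
have half x : x = (t - s) / 2 -> x `^ a = q * (t - s) `^ a.
  by move=> ->; rewrite powRM ?invr_ge0 ?subr_ge0 ?(ltW st)// mulrC.
have ms : (s + t) / 2 - s = (t - s) / 2 by lra.
have mt : t - (s + t) / 2 = (t - s) / 2 by lra.
rewrite powR_cube -[_ ^+ 3]mul1r.
have h0 : 0 <= (t - s) `^ a by exact: powR_ge0.
have h3 : 0 <= ((t - s) `^ a) ^+ 3 by rewrite exprn_ge0.
have qh : q ^+ 3 * ((t - s) `^ a) ^+ 3 <= 2^-1 * ((t - s) `^ a) ^+ 3.
  by rewrite ler_wpM2r.
have qh1 : q * ((t - s) `^ a) ^+ 3 <= ((t - s) `^ a) ^+ 3.
  by rewrite ler_piMl.
apply: rough_germ_defect; [by []|lra|lra|by []|..];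
  rewrite (half _ ms) (half _ mt); lra.
Qed.

End rough_germ.

(** * Sewing the nonlinear rough germ *)

Theorem theorem3p10 (R : realType) (V : completeNormedModType R)
  (hV : separable V) (T : R) (hT : 0 < T)
  (a : R) (ha : 3^-1 < a <= 2^-1)
  (b : nat -> R) (hb : forall k, (k <= 2)%N -> 0 <= b k)
  (W : R -> V -> V) (WW : R -> R -> sumprod V V -> V)
  (hW : nl_rough_path T a 2 b W WW)
  (Y dY : R -> V) (hY : controlled T a W Y dY) :
  let Xi : R -> R -> V := fun s t => incr W s t (Y s) + WW s t (dY s, Y s) in
  let k_a : R := (1 - 2 `^ (1 - 3 * a))^-1 in
  let C1 : R :=
    k_a * norm_rough_path T a 2 b W WW *
    (1 + 2 * fine (enorm_oo T dY)) `^ Num.max (b 0%N) (b 1%N) *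
    (1 + 2 * fine (enorm_oo T Y)) `^ Num.max (b 1%N) (b 2%N) *
    (fine (enorm_holder T a Y) + fine (enorm_holder T a dY) +
     fine (enorm2 T (2 * a) (remainder W Y dY))) in
  forall s t : R, 0 <= s -> s <= t -> t <= T ->
    cvg (partition_sum Xi s p @[p --> mesh_filter s t]) /\
    `|sewing Xi s t - Xi s t| <= C1 * `|t - s| `^ (3 * a).
Proof.
move=> Xi k_a C1 s t s0 st tT.
have [a3 a2] : 3^-1 < a /\ a <= 2^-1 by apply/andP.
have a0 : 0 < a by lra.
have b0 : 0 <= b 0%N by exact: hb.
have b1 : 0 <= b 1%N by exact: hb.
have a31 : 1 < 3 * a by lra.
pose K := rough_const T a b W WW Y dY.
have K0 : 0 <= K by exact: rough_const_ge0.
have XiK := rough_germ_almost_additive hT a0 b0 b1 hW hY.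
have K20 : 0 <= K * 2 by rewrite mulr_ge0.
split; first exact: (partition_sum_cvg a31 K20 XiK s0 st tT).
have XiM s' t' (s'0 : 0 <= s') (s't' : s' <= t') (t'T : t' <= T) :=
  rough_germ_midpoint hT a0 b0 b1 hW hY (ltW a31) s'0 s't' t'T.
have := sewing_germ a31 K20 XiK K0 XiM s0 st tT.
rewrite ger0_norm ?subr_ge0//; congr (_ <= _ * _).
by rewrite /C1 /k_a /K /rough_const mulrC !mulrA.
Qed.
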